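(* Let $U_8^{14}$ be the set of all $L(C)\in TLeib_8$ with $c_{3,4}=0$, $c_{2,3}\neq 0$, $c_{1,1}=c_{0,1}=0$, $c_{1,2}\neq 0$, $2c_{2,4}c_{1,2}^2-3c_{1,3}c_{2,3}c_{1,2}+3c_{1,3}c_{2,3}^2=0$ and $c_{0,0}\neq 0$. 1. Two algebras $L(C)$ and $L(C')$ from $U_8^{14}$ are isomorphic if and only if $\frac{c'_{1,2}}{c'_{2,3}}=\frac{c_{1,2}}{c_{2,3}}$. 2. For any $\lambda\in\mathbb{C}^*=\mathbb{C}\setminus\{0\}$ there exists $L(C)\in U_8^{14}$ with $\frac{c_{1,2}}{c_{2,3}}=\lambda$. Moreover, the orbits (isomorphism classes) in $U_8^{14}$ are parameterized by the algebras $L(1,0,0,\lambda,0,0,0,1,0,0)$, $\lambda\in\mathbb{C}^*$: these algebras lie in $U_8^{14}$ and every algebra in $U_8^{14}$ is isomorphic to one of them.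
   Context: All algebras are over $\mathbb{C}$. For $C=(c_{0,0},c_{0,1},c_{1,1},c_{1,2},c_{1,3},c_{1,4},c_{1,5},c_{2,3},c_{2,4},c_{3,4})\in\mathbb{C}^{10}$, $L(C)$ denotes the $8$-dimensional complex algebra with basis $e_0,\dots,e_7$ and products (products of basis vectors not listed are zero): $[e_i,e_0]=e_{i+1}$ for $1\le i\le 6$; $[e_0,e_i]=-e_{i+1}$ for $2\le i\le 6$; $[e_0,e_0]=c_{0,0}e_7$; $[e_0,e_1]=-e_2+c_{0,1}e_7$; $[e_1,e_1]=c_{1,1}e_7$; $[e_1,e_2]=-[e_2,e_1]=c_{1,2}e_4+c_{1,3}e_5+c_{1,4}e_6+c_{1,5}e_7$; $[e_1,e_3]=-[e_3,e_1]=c_{1,2}e_5+c_{1,3}e_6+c_{1,4}e_7$; $[e_1,e_4]=-[e_4,e_1]=(c_{1,2}-c_{2,3})e_6+(c_{1,3}-c_{2,4})e_7$; $[e_1,e_5]=-[e_5,e_1]=(c_{1,2}-2c_{2,3})e_7$; $[e_2,e_3]=-[e_3,e_2]=c_{2,3}e_6+c_{2,4}e_7$; $[e_2,e_4]=-[e_4,e_2]=c_{2,3}e_7$; $[e_i,e_{7-i}]=-[e_{7-i},e_i]=(-1)^ic_{3,4}e_7$ for $1\le i\le 6$. $TLeib_8$ is the set of all $L(C)$ with $c_{3,4}(c_{2,3}+2c_{1,2})=0$ (the condition for $L(C)$ to be a Leibniz algebra, i.e. to satisfy $[x,[y,z]]=[[x,y],z]-[[x,z],y]$). The entries of $C'$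 are denoted $c'_{i,j}$, in the same order. ''Isomorphic'' means isomorphic as algebras over $\mathbb{C}$; an orbit is an isomorphism class. *)

(* Defs.v *)
From HB Require Import structures.
From mathcomp Require Import all_boot all_order all_algebra.
From mathcomp Require Import reals.
From mathcomp Require Import complex.

Set Implicit Arguments.
Unset Strict Implicit.
Unset Printing Implicit Defensive.

Import GRing.Theory.
Local Open Scope ring_scope.

(* An algebra over F need not be associative, so it is given by a module
   together with a product on it. *)
Definition alg_isomorphic (F : fieldType) (U V : lmodType F)
    (mulU : U -> U -> U) (mulV : V -> V -> V) : Prop :=
  exists f : {linear U -> V},
    bijective f /\ forall x y : U, f (mulU x y) = mulV (f x) (f y).

Record params (F : Type) := Params {
  c00 : F; c01 : F; c11 : F; c12 : F; c13 : F;
  c14 : F; c15 : F; c23 : F; c24 : F; c34 : F }.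

Section Algebras.
Variable F : fieldType.
Implicit Type C : params F.

(* The basis e_0, ..., e_7 of F^8; only meaningful for k < 8. *)
Definition e (k : nat) : 'rV[F]_8 := delta_mx 0 (inord k).

Definition br12 C : 'rV[F]_8 :=
  c12 C *: e 4 + c13 C *: e 5 + c14 C *: e 6 + c15 C *: e 7.
Definition br13 C : 'rV[F]_8 :=
  c12 C *: e 5 + c13 C *: e 6 + c14 C *: e 7.
Definition br14 C : 'rV[F]_8 :=
  (c12 C - c23 C) *: e 6 + (c13 C - c24 C) *: e 7.
Definition br15 C : 'rV[F]_8 := (c12 C - 2%:R * c23 C) *: e 7.
Definition br23 C : 'rV[F]_8 := c23 C *: e 6 + c24 C *: e 7.
Definition br24 C : 'rV[F]_8 := c23 C *: e 7.

(* The product [e_i, e_j], for i, j < 8. The last clause is reached only with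
   i, j >= 1, so that i + j = 7 there means j = 7 - i with 1 <= i <= 6; since
   (-1)^(7-i) = - (-1)^i, it also encodes [e_(7-i), e_i] = - [e_i, e_(7-i)]. *)
Definition basis_bracket C (i j : nat) : 'rV[F]_8 :=
  match i, j with
  | 0, 0 => c00 C *: e 7
  | 0, 1 => - e 2 + c01 C *: e 7
  | 0, _ => if (j <= 6)%N then - e j.+1 else 0
  | _, 0 => if (i <= 6)%N then e i.+1 else 0
  | 1, 1 => c11 C *: e 7
  | 1, 2 => br12 C | 2, 1 => - br12 C
  | 1, 3 => br13 C | 3, 1 => - br13 C
  | 1, 4 => br14 C | 4, 1 => - br14 C
  | 1, 5 => br15 C | 5, 1 => - br15 C
  | 2, 3 => br23 C | 3, 2 => - br23 C
  | 2, 4 => br24 C | 4, 2 => - br24 C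
  | _, _ => if (i + j == 7)%N then ((-1) ^+ i * c34 C) *: e 7 else 0
  end.

(* The product of L(C), extended bilinearly from the basis. *)
Definition L C (x y : 'rV[F]_8) : 'rV[F]_8 :=
  \sum_(i < 8) \sum_(j < 8) (x 0 i * y 0 j) *: basis_bracket C i j.

(* Sets of algebras L(C) are described by predicates on C; no information is
   lost, since C can be read off the structure constants of L(C). *)
Definition TLeib8 C : Prop := c34 C * (c23 C + 2%:R * c12 C) = 0.

Definition U8_14 C : Prop :=
  TLeib8 C /\
  c34 C = 0 /\
  c23 C != 0 /\
  (c11 C = c01 C /\ c01 C = 0) /\
  c12 C != 0 /\
  2%:R * c24 C * c12 C ^+ 2 - 3%:R * c13 C * c23 C * c12 C
    + 3%:R * c13 C * c23 C ^+ 2 = 0 /\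
  c00 C != 0.

Definition L_isomorphic C C' : Prop := alg_isomorphic (L C) (L C').

End Algebras.

(* Main.v *)
From HB Require Import structures.
Require Import Defs.
From mathcomp Require Import all_boot all_order all_algebra.
From mathcomp Require Import reals.
From mathcomp Require Import complex.
From mathcomp Require Import ring.
Import GRing.Theory Num.Theory.
Local Open Scope ring_scope.

(** Everything follows from two facts about the ratio [c12 / c23].

    It is an invariant.  Let [I_k] be the span of [e_k, ..., e_7].  When
    [c34 = 0], an isomorphism [f] maps [e_k] into [I_k] for [k >= 2], and
    [f e_1] has no component along [e_0].  Writing [A] for the
    [e_0]-component of [f e_0] and [B] for the [e_1]-component of [f e_1], the
    leading terms of the images of [[e_1, e_2] = c12 e_4 + ...] and of
    [[e_2, e_3] = c23 e_6 + ...] give [A^2 c12 = B c12'] and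
    [A^2 c23 = B c23'] ([isomorphic_ratio]).

    Conversely the ratio is the only invariant, because every algebra of the
    family reduces to [L(1,0,0,lambda,0,0,0,1,0,0)], [lambda = c12 / c23]
    ([normal_form]).  Give [e_0] weight 1 and [e_i] weight [i + 1] for
    [i >= 1]: then [c12] and [c23] have weight 0, [c13] and [c24] weight 1,
    [c14] weight 2 and [c15] weight 3.  Three changes of the generators
    [e_0], [e_1] work by increasing weight.
    - [shear_isomorphic]: [e_0 + b e_1] moves [(c13, c24)] along the line
      spanned by [(2 c12^2, 3 c23 (c12 - c23))].  The polynomial equation
      defining the family says exactly that [(c13, c24)] is on that line, so
      both parameters can be made to vanish.
    - [translate_isomorphic]: [e_1 + p e_3 + q e_4] moves [c14] by a multiple
      of [p c23] and [c15] by a multiple of [q c23].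
    - [scale_isomorphic]: [A e_0] and [B e_1] multiply [c12] and [c23] by
      [B / A^2], and [c00] by [1 / (A^4 B)].  Making [c23] and [c00] both equal
      to 1 amounts to extracting a sixth root of [c00 c23].
    The conditions [c01 = c11 = 0] are what keeps [[e_0, e_0]] unchanged by the
    shear. *)

(** * Isomorphism of algebras is an equivalence relation *)

Lemma alg_isomorphic_sym (F : fieldType) (U V : lmodType F)
    (mulU : U -> U -> U) (mulV : V -> V -> V) :
  alg_isomorphic mulU mulV -> alg_isomorphic mulV mulU.
Proof.
move=> [f [[g fK gK] fM]].
pose g_linear := GRing.isLinear.Build F V U *:%R g (can2_linear fK gK).
pose gL : {linear V -> U} := HB.pack g g_linear.
exists gL; split; first by exists f.
by move=> x y; apply: (can_inj fK); rewrite fM !gK.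
Qed.

Lemma alg_isomorphic_trans (F : fieldType) (U V W : lmodType F)
    (mulU : U -> U -> U) (mulV : V -> V -> V) (mulW : W -> W -> W) :
  alg_isomorphic mulU mulV -> alg_isomorphic mulV mulW ->
  alg_isomorphic mulU mulW.
Proof.
move=> [f [f_bij fM]] [g [g_bij gM]]; exists (g \o f); split.
  exact: bij_comp.
by move=> x y; rewrite /= fM gM.
Qed.

(** * The bracket in coordinates *)

Lemma forall_lt8 (P : nat -> Prop) :
  P 0 -> P 1 -> P 2 -> P 3 -> P 4 -> P 5 -> P 6 -> P 7 ->
  forall k, (k < 8)%N -> P k.
Proof. by move=> ? ? ? ? ? ? ? ?; do 8![case=> //]. Qed.

Section Coordinates.
Context {F : fieldType}.
Implicit Types (C : params F) (x y v : 'rV[F]_8) (u w : nat -> F).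

(** Indexing by natural numbers makes concrete coordinates compute, which
    ordinals built by [inord] do not. *)
Definition entry v (k : nat) : F := v 0 (inord k).

Lemma entry_inj x y :
  (forall k, (k < 8)%N -> entry x k = entry y k) -> x = y.
Proof.
move=> xy; apply/rowP => j.
by have := xy j (ltn_ord j); rewrite /entry inord_val.
Qed.

Lemma entry_e (i k : nat) :
  (i < 8)%N -> (k < 8)%N -> entry (e F i) k = (k == i)%:R.
Proof. by move=> i8 k8; rewrite /entry mxE eqxx -val_eqE /= !inordK. Qed.

Lemma entryD x y k : entry (x + y) k = entry x k + entry y k.
Proof. exact: mxE. Qed.

Lemma entryN x k : entry (- x) k = - entry x k.
Proof. exact: mxE. Qed.

Lemma entryZ a x k : entry (a *: x) k = a * entry x k.
Proof. exact: mxE. Qed.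

Lemma entry0 k : entry 0 k = 0.
Proof. exact: mxE. Qed.

Definition minor u w (i j : nat) : F := u i * w j - u j * w i.

(** Coordinates of the bracket when [c34 = 0].  All the structure constants
    outside [c00], [c01], [c11] are alternating, hence the minors. *)
Definition bracket_coords C u w : seq F :=
  [:: 0; 0;
    minor u w 1 0;
    minor u w 2 0;
    minor u w 3 0 + c12 C * minor u w 1 2;
    minor u w 4 0 + c13 C * minor u w 1 2 + c12 C * minor u w 1 3;
    minor u w 5 0 + c14 C * minor u w 1 2 + c13 C * minor u w 1 3
      + (c12 C - c23 C) * minor u w 1 4 + c23 C * minor u w 2 3;
    minor u w 6 0 + c15 C * minor u w 1 2 + c14 C * minor u w 1 3
      + (c13 C - c24 C) * minor u w 1 4
      + (c12 C - 2%:R * c23 C) * minor u w 1 5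
      + c24 C * minor u w 2 3 + c23 C * minor u w 2 4
      + c00 C * (u 0 * w 0) + c01 C * (u 0 * w 1) + c11 C * (u 1 * w 1)].

Lemma entry_L C x y k : c34 C = 0 -> (k < 8)%N ->
  entry (L C x y) k = (bracket_coords C (entry x) (entry y))`_k.
Proof.
move=> c34_0; have -> : L C x y = \sum_(0 <= i < 8) \sum_(0 <= j < 8)
    (entry x i * entry y j) *: basis_bracket C i j.
  rewrite big_mkord; apply: eq_bigr => i _; rewrite big_mkord.
  by apply: eq_bigr => j _; rewrite /entry !inord_val.
rewrite /index_iota /= !big_cons !big_nil /=.
rewrite /br12 /br13 /br14 /br15 /br23 /br24 c34_0 => k8.
rewrite !(entryD, entryZ, entryN, entry0) !entry_e // /bracket_coords /minor.
move: (entry x) (entry y) => {}x {}y.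
by move: k k8; apply: forall_lt8 => /=; ring.
Qed.

Lemma L_e C i j : (i < 8)%N -> (j < 8)%N ->
  L C (e F i) (e F j) = basis_bracket C i j.
Proof.
move=> i8 j8; rewrite /L (bigD1 (inord i)) //= (bigD1 (inord j)) //= !big1.
- by rewrite !addr0 !mxE !eqxx mulr1 scale1r !inordK.
- move=> k ki; rewrite big1 // => l _.
  by rewrite !mxE (negbTE ki) mul0r scale0r.
- by move=> l lj; rewrite !mxE (negbTE lj) mulr0 scale0r.
Qed.

(** * Isomorphisms given by a change of basis *)

(** The default value 0 of [nth] pads short rows, so trailing zeros can be
    left out. *)
Definition rows_mx (s : seq (seq F)) : 'M[F]_8 :=
  \matrix_(i, j) (nth [::] s i)`_j.

(** Written as an explicit sum so that it unfolds by mere computation. *)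
Definition row_comb (s : seq (seq F)) u (k : nat) : F :=
  let t i := u i * (nth [::] s i)`_k in
  t 0%N + t 1%N + t 2 + t 3 + t 4 + t 5 + t 6 + t 7.

Lemma entry_mul_rows v s k :
  (k < 8)%N -> entry (v *m rows_mx s) k = row_comb s (entry v) k.
Proof.
move=> k8; rewrite /entry mxE.
transitivity (\sum_(0 <= i < 8) entry v i * (nth [::] s i)`_k).
  rewrite big_mkord; apply: eq_bigr => i _.
  by rewrite mxE inordK // /entry inord_val.
by rewrite /index_iota /= !big_cons big_nil addr0 !addrA.
Qed.

Lemma eq_bracket_coords C u w u' w' :
  (forall k, (k < 8)%N -> u k = u' k) -> (forall k, (k < 8)%N -> w k = w' k) ->
  bracket_coords C u w = bracket_coords C u' w'.
Proof. by move=> uu' ww'; rewrite /bracket_coords /minor !uu' ?ww'. Qed.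

(** If the rows of [s] are the coordinates in [L C'] of vectors that multiply
    as the basis of [L C] does, these vectors define a homomorphism from [L C];
    triangularity makes it bijective.  Quantifying over coordinate functions
    turns the multiplicativity into polynomial identities. *)
Lemma rows_isomorphic C C' (s : seq (seq F)) :
  c34 C = 0 -> c34 C' = 0 ->
  (forall i, (i < 8)%N -> (nth [::] s i)`_i != 0) ->
  (forall i, (i < 8)%N -> forall j, (j < i)%N -> (nth [::] s i)`_j = 0) ->
  (forall u w k, (k < 8)%N ->
     row_comb s (nth 0 (bracket_coords C u w)) k =
     (bracket_coords C' (row_comb s u) (row_comb s w))`_k) ->
  L_isomorphic C C'.
Proof.
move=> C0 C'0 diag trig mulP; pose M := rows_mx s.
have Munit : M \in unitmx.
  rewrite unitmxE -det_tr det_trig.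
    by rewrite unitfE; apply/prodf_neq0 => i _; rewrite !mxE diag.
  by apply/is_trig_mxP => i j ij; rewrite !mxE trig.
exists (mulmxr M); split => [|x y /=].
  by exists (mulmx^~ (invmx M)); [exact: mulmxK | exact: mulmxKV].
apply: entry_inj => k k8; rewrite entry_mul_rows // entry_L //.
rewrite (@eq_bracket_coords _ _ _ (row_comb s (entry x)) (row_comb s (entry y)));
  [| by move=> *; rewrite entry_mul_rows..].
by rewrite -mulP // /row_comb !entry_L.
Qed.

Lemma scale_isomorphic (A B lambda d : F) :
  A != 0 -> B != 0 -> A ^+ 2 = B * d ->
  L_isomorphic (Params 1 0 0 lambda 0 0 0 1 0 0)
    (Params (A ^+ 4 * B) 0 0 (lambda * d) 0 0 0 d 0 0).
Proof.
move=> A0 B0 AB; have -> : d = A ^+ 2 / B by rewrite AB mulrAC mulfV ?mul1r.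
apply: (@rows_isomorphic _ _
  [:: [:: A];
      [:: 0; B];
      [:: 0; 0; A * B];
      [:: 0; 0; 0; A ^+ 2 * B];
      [:: 0; 0; 0; 0; A ^+ 3 * B];
      [:: 0; 0; 0; 0; 0; A ^+ 4 * B];
      [:: 0; 0; 0; 0; 0; 0; A ^+ 5 * B];
      [:: 0; 0; 0; 0; 0; 0; 0; A ^+ 6 * B]]) => //.
- by apply: forall_lt8; rewrite /= ?mulf_neq0 ?expf_neq0.
- by apply: forall_lt8; do 8?[case=> //].
- move=> u w; apply: forall_lt8; rewrite /row_comb /bracket_coords /minor /=;
    field; rewrite ?A0 ?B0 //.
Qed.

(** Since [e_0] is kept and right multiplication by it shifts the other basis
    vectors, the change [e_1 -> e_1 + p e_3 + q e_4] propagates to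
    [e_i -> e_i + p e_(i+2) + q e_(i+3)]. *)
Lemma translate_isomorphic (c a d p q : F) :
  L_isomorphic (Params c 0 0 a 0 0 0 d 0 0)
    (Params c 0 0 a 0 (2%:R * p * d) (3%:R * q * d) d 0 0).
Proof.
apply: (@rows_isomorphic _ _
  [:: [:: 1];
      [:: 0; 1; 0; p; q];
      [:: 0; 0; 1; 0; p; q];
      [:: 0; 0; 0; 1; 0; p; q];
      [:: 0; 0; 0; 0; 1; 0; p; q];
      [:: 0; 0; 0; 0; 0; 1; 0; p];
      [:: 0; 0; 0; 0; 0; 0; 1];
      [:: 0; 0; 0; 0; 0; 0; 0; 1]]) => //.
- by apply: forall_lt8; rewrite /= ?oner_eq0.
- by apply: forall_lt8; do 8?[case=> //].
- by move=> u w; apply: forall_lt8;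
    rewrite /row_comb /bracket_coords /minor /=; ring.
Qed.

(** The rows are [e_0 + b e_1], [e_1], and their iterated brackets
    [e'_(i+1) = [e'_i, e'_0]]; expanding [[e'_1, e'_2]] in this basis gives the
    values of [c14] and [c15] after the shear. *)
Lemma shear_isomorphic (c a s t d b : F) :
  L_isomorphic
    (Params c 0 0 a 0 (s - 5%:R * a ^+ 3 * b ^+ 2 + a ^+ 2 * b ^+ 2 * d)
       (t + 6%:R * a * b * s - 16%:R * a ^+ 4 * b ^+ 3
          + 12%:R * a ^+ 3 * b ^+ 3 * d - 3%:R * b * d * s) d 0 0)
    (Params c 0 0 a (- (2%:R * a ^+ 2 * b)) s t d
       (- (3%:R * d * (a - d) * b)) 0).
Proof.
apply: (@rows_isomorphic _ _
  [:: [:: 1; b];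
      [:: 0; 1];
      [:: 0; 0; 1];
      [:: 0; 0; 0; 1; - (a * b); 2%:R * a ^+ 2 * b ^+ 2; - (b * s);
          - (b * t)];
      [:: 0; 0; 0; 0; 1; - (2%:R * a * b);
          5%:R * a ^+ 2 * b ^+ 2 - a * b ^+ 2 * d;
          - (2%:R * b * s) - 4%:R * a ^+ 3 * b ^+ 3
            + 7%:R * a ^+ 2 * b ^+ 3 * d - 3%:R * a * b ^+ 3 * d ^+ 2];
      [:: 0; 0; 0; 0; 0; 1; b * (d - 3%:R * a);
          9%:R * a ^+ 2 * b ^+ 2 - 8%:R * a * b ^+ 2 * d
            + 3%:R * b ^+ 2 * d ^+ 2];
      [:: 0; 0; 0; 0; 0; 0; 1; b * (3%:R * d - 4%:R * a)];
      [:: 0; 0; 0; 0; 0; 0; 0; 1]]) => //.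
- by apply: forall_lt8; rewrite /= ?oner_eq0.
- by apply: forall_lt8; do 8?[case=> //].
- by move=> u w; apply: forall_lt8;
    rewrite /row_comb /bracket_coords /minor /=; ring.
Qed.

(** * Invariance of the ratio *)

Definition in_tail (k : nat) v := forall j, (j < k)%N -> entry v j = 0.

(** This form can be rewritten with repeatedly, since [u] is opaque. *)
Lemma in_tailP k v : in_tail k v ->
  exists u : nat -> F, forall j, entry v j = if (j < k)%N then 0 else u j.
Proof. by move=> vk; exists (entry v) => j; case: ifP => // /vk. Qed.

(** Right multiplication raises the filtration by one, and acts on the leading
    coefficient only through the [e_0]-component, because [[e_k, e_i]] lies in
    the span of [e_(k+2), ..., e_7] when [k >= 2] and [i >= 1]. *)
Lemma L_tail C k v x : c34 C = 0 -> (2 <= k <= 6)%N -> in_tail k v ->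
  in_tail k.+1 (L C v x) /\ entry (L C v x) k.+1 = entry v k * entry x 0.
Proof.
move=> c0 /andP[k2 k6] /in_tailP[u vE].
have kS8 : (k.+1 < 8)%N by [].
have k8 := ltnW kS8; split=> [j jk|].
- have j8 : (j < 8)%N by exact: leq_trans jk k8.
  rewrite entry_L // /bracket_coords /minor !vE.
  move: {kS8} k k8 k2 k6 jk {vE}; apply: forall_lt8 => // _ _;
    by move: j j8; apply: forall_lt8 => // _ /=; ring.
- rewrite entry_L // /bracket_coords /minor !vE.
  by move: {kS8} k k8 k2 k6 {vE}; apply: forall_lt8 => // _ _ /=; ring.
Qed.

Lemma isomorphic_ratio C C' : c34 C = 0 -> c34 C' = 0 ->
  L_isomorphic C C' -> c12 C * c23 C' = c12 C' * c23 C.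
Proof.
move=> C0 C'0 [f [/bij_inj f_inj fM]].
pose x := f (e F 0); pose y := f (e F 1); pose g k := f (e F k).
pose D := entry y 1 * entry x 0 - entry y 0 * entry x 1.
have gS k : (1 <= k <= 6)%N -> g k.+1 = L C' (g k) x.
  move=> /andP[k1 k6]; have k8 : (k < 8)%N by exact: leq_trans k6 _.
  by rewrite -fM L_e //; move: k k8 k1 k6; apply: forall_lt8.
have gP k : (2 <= k <= 7)%N ->
    in_tail k (g k) /\ entry (g k) k = D * entry x 0 ^+ (k - 2).
  elim: k => // -[|[|k]] // IH k7.
    rewrite gS //; split=> [[|[|//]] _|]; rewrite entry_L //=.
    by rewrite /minor expr0 mulr1.
  have [tail_k lead_k] := IH (ltnW k7); rewrite gS //.
  have [tail_kS ->] := L_tail C' k.+2 _ x C'0 k7 tail_k.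
  by rewrite lead_k -mulrA -exprSr !subSS !subn0.
(* The image of [e_7] is [D x_0^5 e_7], so injectivity forces [D] and [x_0] to
   be nonzero. *)
have : entry (g 7) 7 != 0.
  apply/eqP => g77; have [g7 _] := gP 7 isT.
  have : e F 7 = 0.
    apply: f_inj; rewrite raddf0; apply: entry_inj => k.
    by rewrite entry0 ltnS leq_eqVlt; case/orP => [/eqP -> //|/g7].
  move=> /(congr1 (entry ^~ 7%N)); rewrite entry_e // entry0 /= => /eqP.
  by rewrite oner_eq0.
rewrite (gP 7 isT).2 mulf_eq0 expf_eq0 negb_or /= => /andP[D0 x0].
have [g2 g22] := gP 2 isT; have [g3 g33] := gP 3 isT.
have [g4 g44] := gP 4 isT; have [g5 _] := gP 5 isT.
have [g6 g66] := gP 6 isT; have [g7 _] := gP 7 isT.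
have [u2 g2E] := in_tailP _ _ g2; have [u3 g3E] := in_tailP _ _ g3.
have f12 : L C' y (g 2) =
    c12 C *: g 4 + c13 C *: g 5 + c14 C *: g 6 + c15 C *: g 7.
  by rewrite -fM L_e //= /br12 !linearD !linearZ.
have f23 : L C' (g 2) (g 3) = c23 C *: g 6 + c24 C *: g 7.
  by rewrite -fM L_e //= /br23 !linearD !linearZ.
(* [[e_1, e_2]] lies in the span of [e_4, ..., e_7], whereas the
   [e_3]-coordinate of the bracket of the images is [- y_0 D]. *)
have y0 : entry y 0 = 0.
  have /eqP := congr1 (entry ^~ 3%N) f12.
  rewrite entry_L //= /minor !(entryD, entryZ) g4 // g5 // g6 // g7 //.
  rewrite g22 (g2 0%N) // expr0 !mulr0 !addr0 mulr1 sub0r oppr_eq0.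
  by rewrite mulf_eq0 (negbTE D0) orbF => /eqP.
have E12 : c12 C * entry x 0 ^+ 2 = c12 C' * entry y 1.
  apply: (mulIf D0); have := congr1 (entry ^~ 4%N) f12.
  rewrite entry_L //= /minor !(entryD, entryZ) g5 // g6 // g7 // y0 g22 g44.
  rewrite !g2E /= => E; transitivity (c12 C * (D * entry x 0 ^+ (4 - 2))
    + c13 C * 0 + c14 C * 0 + c15 C * 0); first by ring.
  by rewrite -E; ring.
have E23 : c23 C * entry x 0 ^+ 2 = c23 C' * entry y 1.
  have nz : D * entry x 0 ^+ 2 != 0 by rewrite mulf_neq0 ?expf_neq0.
  apply: (mulIf nz); have := congr1 (entry ^~ 6%N) f23.
  rewrite entry_L //= /minor !(entryD, entryZ) g7 // g22 g33 g66.
  rewrite !g2E !g3E /= => E.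
  transitivity (c23 C * (D * entry x 0 ^+ (6 - 2)) + c24 C * 0); first by ring.
  by rewrite -E /D y0; ring.
have y1 : entry y 1 != 0.
  by apply: contraNneq D0 => y1; rewrite /D y0 y1 !mul0r subrr.
apply: (mulIf y1); rewrite -mulrA -E23 mulrCA mulrA mulrC.
by rewrite [in RHS]mulrAC -E12; ring.
Qed.

End Coordinates.

(** * The normal form *)

Lemma normal_form (F : numClosedFieldType) (C : params F) : U8_14 C ->
  L_isomorphic (Params 1 0 0 (c12 C / c23 C) 0 0 0 1 0 0) C.
Proof.
case: C => c c01' c11' a c13' s t d c24' c34'.
move=> [_] /= [-> [d0 [[-> ->] [a0 [quadric c0]]]]].
pose b := - c13' / (2%:R * a ^+ 2).
have c13E : c13' = - (2%:R * a ^+ 2 * b)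
  by rewrite /b; field.
have c24E : c24' = - (3%:R * d * (a - d) * b).
  have nz : 2%:R * a ^+ 2 != 0 by rewrite mulf_neq0 ?expf_neq0 ?pnatr_eq0.
  apply: (mulIf nz); apply/eqP; rewrite -subr_eq0 -quadric c13E; apply/eqP.
  by ring.
rewrite c13E c24E.
apply: alg_isomorphic_trans (shear_isomorphic c a s t d b).
set s' := s - _ + _; set t' := t + _ - _ + _ - _.
have -> : s' = 2%:R * (s' / (2%:R * d)) * d by field.
have -> : t' = 3%:R * (t' / (3%:R * d)) * d by field.
apply: alg_isomorphic_trans (translate_isomorphic c a d _ _).
(* [scale_isomorphic] must produce [c] as [A^4 B] with [A^2 = B d]: hence
   [B = A^2 / d] and [A^6 = c d]. *)
pose A := 6.-root (c * d).
have A6 : A ^+ 6 = c * d by rewrite rootCK.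
have A0 : A != 0.
  by apply: contraNneq (mulf_neq0 c0 d0) => A0; rewrite -A6 A0 expr0n.
have cE : c = A ^+ 4 * (A ^+ 2 / d).
  by rewrite mulrA -exprD A6 mulfK.
have := scale_isomorphic A (A ^+ 2 / d) (a / d) d.
rewrite -cE !divfK //; apply=> //.
by rewrite mulf_neq0 ?invr_neq0 ?expf_neq0.
Qed.

Theorem proposition2p21 (R : realType) :
  (forall C C' : params R[i], U8_14 C -> U8_14 C' ->
     (L_isomorphic C C' <-> c12 C' / c23 C' = c12 C / c23 C)) /\
  (forall lambda : R[i], lambda != 0 ->
     exists C : params R[i], U8_14 C /\ c12 C / c23 C = lambda) /\
  (forall lambda : R[i], lambda != 0 ->
     U8_14 (Params 1 0 0 lambda 0 0 0 1 0 0)) /\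
  (forall C : params R[i], U8_14 C ->
     exists lambda : R[i], lambda != 0 /\
       L_isomorphic C (Params 1 0 0 lambda 0 0 0 1 0 0)).
Proof.
have normal_in_U (lambda : R[i]) : lambda != 0 ->
    U8_14 (Params 1 0 0 lambda 0 0 0 1 0 0).
  by move=> lambda0; rewrite /U8_14 /TLeib8 /= oner_eq0; do !split => //; ring.
split; [|split; [|split=> //]].
- move=> C C' UC UC'.
  have [_ [C0 [d0 _]]] := UC; have [_ [C'0 [d'0 _]]] := UC'; split=> [iso|ratio].
    by apply/eqP; rewrite eqr_div // (isomorphic_ratio C C').
  apply: alg_isomorphic_trans (normal_form _ C' UC'); rewrite ratio.
  exact/alg_isomorphic_sym/normal_form.
- move=> lambda lambda0; exists (Params 1 0 0 lambda 0 0 0 1 0 0).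
  by split; [exact: normal_in_U | rewrite /= divr1].
- move=> C UC; have [_ [_ [d0 [_ [a0 _]]]]] := UC.
  exists (c12 C / c23 C); split; first by rewrite mulf_neq0 ?invr_neq0.
  exact/alg_isomorphic_sym/normal_form.
Qed.
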